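(* Let $p$ be a prime greater than $2$, $m$ a positive integer, and $f \colon GF(p)^{2m} \to GF(p)$ an even function with $f(0)=0$. If the component Cayley graphs of $f$ are all strongly regular and are either all of feasible Latin square type or all of feasible negative Latin square type, then $f$ is bent.
   Context: Let $\zeta = e^{2\pi i/p}$, identify $GF(p)$ with $\{0,\dots,p-1\}$. The Walsh transform of $f$ is $W_f(x) = \sum_y \zeta^{f(y) - \langle x,y\rangle}$ ($\langle\ ,\ \rangle$ the standard inner product); $f$ is bent if $|W_f(x)| = p^m$ for all $x \in GF(p)^{2m}$. Level sets: $D_i = f^{-1}(i)$ for $1 \le i \le p-1$, $D_p = f^{-1}(0)\setminus\{0\}$. The component Cayley graph $\Gamma_i$ ($1 \le i \le p$) has vertex set $GF(p)^{2m}$, with distinct $x,y$ adjacent iff $x-y \in D_i$. A strongly regular graph with parameters $(\nu,k,\lambda,\mu)$ is a $k$-regular graph on $\nu$ vertices in which adjacent vertices have $\lambda$ common neighbors and distinct nonadjacent vertices have $\mu$ common neighbors. The graphs are all of feasible Latin square type (resp. feasible negative Latin square type) if each $\Gamma_i$ is strongly regular with parameters $(N^2, (N-1)r_i, N + r_i^2 - 3r_i, r_i^2 - r_i)$, where $N = p^m$ (resp. $N = -p^m$), $r_i = N/p$ for $1 \le i \le p-1$, and $r_p = N/p + 1$. *)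

(* Defs.v *)
From mathcomp Require Import all_boot all_order all_algebra.
From mathcomp Require Import complex.
From mathcomp Require Import reals trigo.

Set Implicit Arguments.
Unset Strict Implicit.
Unset Printing Implicit Defensive.

Import Order.TTheory GRing.Theory Num.Theory.
Local Open Scope ring_scope.
Local Open Scope complex_scope.

(* e^{2 pi i / p} *)
Definition zeta (R : realType) (p : nat) : R[i] :=
  cos (2 * pi / p%:R) +i* sin (2 * pi / p%:R).

Definition inner (p n : nat) (x y : 'rV['F_p]_n) : 'F_p :=
  \sum_(i < n) x 0 i * y 0 i.

(* The exponent f y - <x, y> is computed in 'F_p and then read as its
   representative in {0, ..., p-1} through the coercion of 'F_p to nat. *)
Definition walsh (R : realType) (p n : nat) (f : 'rV['F_p]_n -> 'F_p)
    (x : 'rV['F_p]_n) : R[i] :=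
  \sum_(y : 'rV['F_p]_n) zeta R p ^+ (f y - inner x y)%R.

Definition bent (R : realType) (p m : nat)
    (f : 'rV['F_p]_(2 * m) -> 'F_p) : Prop :=
  forall x : 'rV['F_p]_(2 * m), `|walsh R f x| = (p ^ m)%:R.

(* Only meaningful for 1 <= i <= p. *)
Definition level_set (p n : nat) (f : 'rV['F_p]_n -> 'F_p) (i : nat) :
    {set 'rV['F_p]_n} :=
  if i == p then [set x | f x == 0] :\ 0 else [set x | f x == i :> nat].

Definition component_graph (p n : nat) (f : 'rV['F_p]_n -> 'F_p) (i : nat) :
    rel 'rV['F_p]_n :=
  [rel x y | (x != y) && (x - y \in level_set f i)].

(* The parameters are integers because the formulas below can be negative:
   for N = - p and r = 0 the graph has no edge and lambda = - p is vacuous. *)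
Definition strongly_regular (T : finType) (e : rel T) (nu k lambda mu : int) :
    Prop :=
  [/\ symmetric e /\ irreflexive e,
      #|T|%:Z = nu,
      forall x, #|[set y | e x y]|%:Z = k,
      forall x y, e x y -> #|[set z | e x z && e y z]|%:Z = lambda
    & forall x y, x != y -> ~~ e x y ->
        #|[set z | e x z && e y z]|%:Z = mu].

(* The quotient is exact for N = p ^ m and N = - p ^ m with 0 < m. *)
Definition feasible_r (p : nat) (N : int) (i : nat) : int :=
  if i == p then (N %/ p%:Z)%Z + 1 else (N %/ p%:Z)%Z.

Definition feasible_type (p n : nat) (f : 'rV['F_p]_n -> 'F_p) (N : int) :
    Prop :=
  forall i : nat, (1 <= i <= p)%N ->
    let r := feasible_r p N i in
    strongly_regular (component_graph f i)
      (N ^+ 2) ((N - 1) * r) (N + r ^+ 2 - 3 * r) (r ^+ 2 - r).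

Definition feasible_latin (p m : nat) (f : 'rV['F_p]_(2 * m) -> 'F_p) : Prop :=
  feasible_type f (p%:Z ^+ m).

Definition feasible_negative_latin (p m : nat)
    (f : 'rV['F_p]_(2 * m) -> 'F_p) : Prop :=
  feasible_type f (- (p%:Z ^+ m)).

(* For even f the simple-graph clause of strongly_regular is automatic, so it
   adds no hypothesis on f. *)
Lemma component_graph_simple (p n : nat) (f : 'rV['F_p]_n -> 'F_p) (i : nat) :
  (forall x, f (- x) = f x) ->
  symmetric (component_graph f i) /\ irreflexive (component_graph f i).
Proof.
move=> fN; split=> [x y|x]; last by rewrite /component_graph /= eqxx.
rewrite /component_graph /= eq_sym; congr (_ && _); rewrite -opprB /level_set.
by case: ifP => _; rewrite !inE fN ?oppr_eq0.
Qed.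

(* Main.v *)
Require Import Defs.
From mathcomp Require Import all_boot all_order all_algebra.
From mathcomp Require Import complex reals.
From mathcomp Require Import ring trigo.
Local Open Scope ring_scope.

(** Fix an additive character [psi] and let [E a] be the sum of [psi] over the
    fibre [f = a].  Writing [N = p * q], a nontrivial character turns the
    strongly regular graph relation into a quadratic equation with roots
    [N - r] and [- r], hence [E a] is [N - q] or [- q]; since the [E a] add up
    to [0], the value [N - q] is taken exactly once, at [a = c] say.  For the
    trivial character the degrees give the same shape with [c = 0].  In both
    cases [E a] is a constant plus [N] times the indicator of [c], so the Walsh
    value [sum_a zeta ^ a * E a] is [N * zeta ^ c]. *)

Set Implicit Arguments.
Unset Strict Implicit.
Unset Printing Implicit Defensive.

Import Order.TTheory GRing.Theory Num.Theory.

(** * Roots of unity and the additive character of the prime field *)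

Section Character.

Variables (R : realType) (p : nat).
Hypotheses (p_prime : prime p) (p_gt2 : (2 < p)%N).

Lemma zeta_expE (n : nat) :
  zeta R p ^+ n =
    (cos (2 * pi / p%:R *+ n) +i* sin (2 * pi / p%:R *+ n))%C.
Proof.
rewrite /zeta; set t := _ / _.
elim: n => [|n IHn]; first by rewrite expr0 mulr0n cos0 sin0.
rewrite exprS IHn mulrS cosD sinD; congr (_ +i* _)%C.
by rewrite addrC [_ * sin _]mulrC [sin _ * _]mulrC mulrC.
Qed.

Lemma zeta_expp : zeta R p ^+ p = 1.
Proof.
have p0 : p%:R != 0 :> R by rewrite pnatr_eq0 -lt0n prime_gt0.
rewrite zeta_expE -mulr_natr mulfVK // mulr_natl.
by rewrite cos2pi sin2pi.
Qed.

Lemma zeta_neq1 : zeta R p != 1.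
Proof.
have p0 : 0 < p%:R :> R by rewrite ltr0n prime_gt0.
apply/eqP => -[_] s0.
(* Since p > 2, the angle lies strictly between 0 and pi, so [zeta] has nonzero imaginary part. *)
have : 0 < sin (2 * pi / p%:R : R).
  apply: sin_gt0_pi; rewrite divr_gt0 ?mulr_gt0 ?pi_gt0 ?ltr0n ?prime_gt0 //=.
  by rewrite ltr_pdivrMr // mulrC ltr_pM2l ?pi_gt0 // ltr_nat.
by move/lt0r_neq0/eqP; apply; exact: s0.
Qed.

Lemma norm_zeta : `|zeta R p| = 1.
Proof.
apply/eqP; rewrite -(@pexpr_eq1 _ _ p) ?prime_gt0 //.
by rewrite -normrX zeta_expp normr1.
Qed.

Definition chi (u : 'F_p) : R[i] := zeta R p ^+ u.

(** Reducing the exponent modulo p is harmless because zeta ^ p = 1. *)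
Lemma chiD (u v : 'F_p) : chi (u + v) = chi u * chi v.
Proof.
rewrite /chi -exprD /= [X in (_ %% X)%N]Fp_cast //.
by rewrite [in RHS](divn_eq (u + v) p) exprD mulnC exprM zeta_expp expr1n mul1r.
Qed.

Lemma norm_chi (u : 'F_p) : `|chi u| = 1.
Proof. by rewrite normrX norm_zeta expr1n. Qed.

Lemma chi1 : chi 1 = zeta R p.
Proof. by rewrite /chi /= [X in (_ %% X)%N]Fp_cast // modn_small ?prime_gt1. Qed.

End Character.

(** * Character sums over finite groups and strongly regular Cayley graphs *)

Lemma sum_character_eq0 (C : idomainType) (G : finZmodType) (psi : G -> C)
    (psiD : {morph psi : x y / x + y >-> x * y}) (g : G) :
  psi g != 1 -> \sum_y psi y = 0.
Proof.
move=> psig; apply/eqP.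
have : (psi g - 1) * \sum_y psi y == 0.
  rewrite mulrBl mul1r subr_eq0 [in X in _ == X](reindex_inj (addrI g)) /=.
  by rewrite mulr_sumr; apply/eqP; apply: eq_bigr => y _; rewrite psiD.
by rewrite mulf_eq0 subr_eq0 (negPf psig).
Qed.

(** Character form of A^2 = k I + l A + mu (J - I - A) for the adjacency matrix A: the all-ones
    matrix J contributes nothing because [psi] sums to 0. *)
Lemma srg_character_sum (C : idomainType) (G : finZmodType) (D : {set G})
    (e : rel G) (nu k l mu : int) (psi : G -> C)
    (eE : forall x y, e x y = (x != y) && (x - y \in D)) :
  {morph psi : x y / x + y >-> x * y} -> psi 0 = 1 -> \sum_y psi y = 0 ->
  0 \notin D -> strongly_regular e nu k l mu ->
  let t := \sum_(y in D) psi y in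
  t ^+ 2 = (k - mu)%:~R + (l - mu)%:~R * t.
Proof.
move=> psiD psi0 sum0 D0 [[esym _] _ degk Hl Hmu] /=.
have eD x y : e x y = (x - y \in D).
  by rewrite eE; case: eqP => // ->; rewrite subrr (negPf D0).
(* By symmetry of [e], [n z] also counts the ways to write z as a sum of two elements of [D]. *)
pose n z := #|[set y | e 0 y && e z y]|.
have nE z : (n z)%:R = mu%:~R + (l - mu)%:~R * (z \in D)%:R
                       + (k - mu)%:~R * (z == 0)%:R :> C.
  rewrite -[(n z)%:R]/((n z)%:Z%:~R); case: (eqVneq z 0) => [->|z0].
    rewrite (negPf D0) /n (_ : [set _ | _] = [set y | e 0 y]); last first.
      by apply/setP => y; rewrite !inE andbb.
    by rewrite degk /=; ring.
  case: (boolP (z \in D)) => zD.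
    by rewrite Hl 1?esym ?eD ?subr0 //=; ring.
  by rewrite Hmu 1?eq_sym // 1?esym ?eD ?subr0 //=; ring.
transitivity (\sum_z (n z)%:R * psi z).
  (* Expand the square and group the pairs of elements of [D] by their sum z. *)
  transitivity (\sum_(a in D) \sum_(z | z - a \in D) psi z).
    rewrite expr2 mulr_suml; apply: eq_bigr => a aD.
    rewrite mulr_sumr (reindex_inj (addIr (- a))) /=.
    by apply: eq_bigr => z _; rewrite -psiD addrC subrK.
  rewrite (exchange_big_dep predT) //=; apply: eq_bigr => z _.
  rewrite sumr_const mulr_natl; congr (_ *+ _); rewrite /n.
  by apply: eq_card => a; rewrite !inE esym !eD subr0.
under [LHS]eq_bigr do rewrite nE !mulrDl -!mulrA !mulr_natl.
rewrite !big_split /= -!mulr_sumr sum0 mulr0 add0r addrC; congr (_ + _).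
  rewrite (bigD1 0) //= eqxx psi0 big1 ?addr0 ?mulr1 // => i /negPf ->.
  by rewrite mulr0n.
by rewrite [in RHS]big_mkcond; congr (_ * _); apply: eq_bigr => z _; case: (z \in D).
Qed.

(** * Character sums over the fibres and the Walsh transform *)

Section Walsh.

Variables (R : realType) (p n : nat) (f : 'rV['F_p]_n -> 'F_p) (N q : int).
Hypotheses (p_prime : prime p) (p_gt2 : (2 < p)%N) (f0 : f 0 = 0).
Hypotheses (NE : N = q * p%:Z) (N_neq0 : N != 0) (f_feasible : feasible_type f N).

Let fibre (a : 'F_p) := [set y | f y == a] :\ 0.
Let r (a : 'F_p) : int := q + (a == 0)%:R.

(** Passes from the labels 1, ..., p to field elements, 0 carrying label p. Deleting the zero vector
    affects only the fibre of 0, as f 0 = 0. *)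
Lemma fibre_srg (a : 'F_p) :
  exists2 e : rel 'rV['F_p]_n,
    forall x y, e x y = (x != y) && (x - y \in fibre a)
  & strongly_regular e (N ^+ 2) ((N - 1) * r a)
      (N + r a ^+ 2 - 3 * r a) (r a ^+ 2 - r a).
Proof.
have p_gt0 := prime_gt0 p_prime.
have qE : (N %/ p%:Z)%Z = q by rewrite NE mulzK // eqz_nat -lt0n.
have a_lt : (a < p)%N by rewrite -[X in (_ < X)%N](Fp_cast p_prime).
pose i : nat := if a == 0 then p else a.
have i_range : (1 <= i <= p)%N.
  rewrite /i; case: (eqVneq a 0) => a0; first by rewrite leqnn p_gt0.
  by rewrite lt0n a0 ltnW.
have rE : feasible_r p N i = r a.
  rewrite /feasible_r /r /i qE; case: (eqVneq a 0) => a0; first by rewrite eqxx.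
  by rewrite ltn_eqF // addr0.
have DE : level_set f i = fibre a.
  rewrite /level_set /fibre /i; case: (eqVneq a 0) => [->|a0]; first by rewrite eqxx.
  rewrite ltn_eqF //; apply/setP => x; rewrite !inE val_eqE.
  by case: (eqVneq x 0) => // ->; rewrite f0 eq_sym (negPf a0).
exists (component_graph f i) => [x y|]; first by rewrite /component_graph /= DE.
by have := f_feasible i_range; rewrite rE.
Qed.

Variable x : 'rV['F_p]_n.
Let psi y := chi R (- inner x y).
Let E (a : 'F_p) : R[i] := \sum_(y | f y == a) psi y.

Lemma psiD : {morph psi : y z / y + z >-> y * z}.
Proof.
move=> y z; rewrite -chiD // -opprD -big_split /=.
by rewrite /psi; congr (chi _ (- _)); apply: eq_bigr => i _; rewrite mxE mulrDr.
Qed.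

Lemma psi0 : psi 0 = 1.
Proof. by rewrite /psi /inner big1 ?oppr0 // => i _; rewrite mxE mulr0. Qed.

Lemma fibre_sumE (a : 'F_p) : E a = (a == 0)%:R + \sum_(y in fibre a) psi y.
Proof.
rewrite /E; case: (eqVneq a 0) => [->|a0].
  rewrite (bigD1 0) ?f0 //= psi0; congr (_ + _).
  by apply: eq_bigl => y; rewrite !inE andbC.
rewrite add0r; apply: eq_bigl => y; rewrite !inE.
by case: (eqVneq y 0) => // ->; rewrite f0 eq_sym (negPf a0).
Qed.

(** The degree (N - 1) r gains 1 from the zero vector when a = 0, which turns the excess N - 1 there
    into N. *)
Lemma fibre_sum_trivial (a : 'F_p) :
  x = 0 -> E a = ((N - 1) * q)%:~R + N%:~R * (a == 0)%:R.
Proof.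
move=> x0; rewrite fibre_sumE.
have psi1 y : psi y = 1.
  by rewrite /psi /inner x0 big1 ?oppr0 // => i _; rewrite mxE mul0r.
have [e eE [[esym _] _ degk _ _]] := fibre_srg a.
under eq_bigr do rewrite psi1.
rewrite sumr_const.
have -> : #|fibre a| = #|[set y | e 0 y]|.
  apply: eq_card => y; rewrite [RHS]inE esym eE subr0.
  by case: (eqVneq y 0) => // ->; rewrite !inE eqxx.
rewrite [X in _ + X = _]pmulrn degk /r; case: (a == 0) => /=; ring.
Qed.

Lemma fibre_sum_nontrivial (a : 'F_p) :
  \sum_y psi y = 0 -> exists b : bool, E a = - q%:~R + N%:~R * b%:R.
Proof.
move=> sum0; rewrite fibre_sumE; have [e eE srg] := fibre_srg a.
have D0 : 0 \notin fibre a by rewrite !inE eqxx.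
have /= := srg_character_sum eE psiD psi0 sum0 D0 srg.
set t := \sum_(_ in _) _ => tE.
(* Here k - mu = r (N - r) and l - mu = N - 2 r. *)
have : (t - (N - r a)%:~R) * (t + (r a)%:~R) == 0.
  by apply/eqP; rewrite -[0](subrr (t ^+ 2)) {2}tE; ring.
rewrite mulf_eq0 subr_eq0 addr_eq0 /r.
(* At a = 0 the term 1 of the zero vector cancels the extra 1 in [r]. *)
by case/orP => /eqP ->; [exists true | exists false]; case: (a == 0) => /=; ring.
Qed.

Lemma fibre_sum_shape :
  exists (c : 'F_p) (s : R[i]), forall a, E a = s + N%:~R * (a == c)%:R.
Proof.
case: (eqVneq x 0) => [x0|/rV0Pn [i xi]].
  by exists 0, ((N - 1) * q)%:~R => a; apply: fibre_sum_trivial.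
have sum0 : \sum_y psi y = 0.
  (* This vector g has - <x, g> = 1, so [psi] takes the value [zeta] at it. *)
  apply: (@sum_character_eq0 _ _ psi psiD (\row_j (- (x 0 i)^-1 *+ (j == i)))).
  rewrite /psi /inner (bigD1 i) //= mxE eqxx big1 ?addr0 => [|j /negPf ji].
    by rewrite mulr1n mulrN opprK divff // chi1 // zeta_neq1.
  by rewrite mxE ji mulr0n mulr0.
have /fin_all_exists [b bE] a := fibre_sum_nontrivial a sum0.
have : \sum_a E a = 0 by rewrite -[RHS]sum0 [RHS](partition_big f predT).
under eq_bigr do rewrite bE.
rewrite big_split /= sumr_const card_Fp // -mulr_sumr -natr_sum.
have -> : - q%:~R *+ p = - N%:~R :> R[i].
  by rewrite NE rmorphM /= -mulr_natr mulNr.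
(* Cancelling N leaves exactly one true bit [b a]: none would give the sum 0, two at least 2. *)
rewrite addrC => /eqP; rewrite subr_eq0 -[X in _ == X]mulr1.
rewrite (inj_eq (mulfI _)) ?intr_eq0 // pnatr_eq1 => /eqP b1.
have [c bc] : exists c, b c.
  apply/existsP; apply: contra_eqT b1 => /existsPn b0.
  by rewrite big1 // => a _; rewrite (negPf (b0 a)).
exists c, (- q%:~R) => a; rewrite bE; congr (_ + _ * (nat_of_bool _)%:R).
case: (eqVneq a c) => [-> //|ac]; apply/negP => ba.
by move: b1; rewrite (bigD1 c) //= (bigD1 a) //= bc ba.
Qed.

Lemma norm_walsh_feasible : `|walsh R f x| = `|N%:~R|.
Proof.
have [c [s EE]] := fibre_sum_shape.
suff -> : walsh R f x = N%:~R * chi R c by rewrite normrM norm_chi // mulr1.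
transitivity (\sum_a chi R a * E a).
  rewrite /walsh (partition_big f predT) //=; apply: eq_bigr => a _.
  by rewrite mulr_sumr; apply: eq_bigr => y /eqP <-; rewrite -chiD.
under eq_bigr do rewrite EE mulrDr.
rewrite big_split /= -mulr_suml.
(* The constant s drops out because [chi] sums to 0 over the field. *)
rewrite (@sum_character_eq0 _ _ (@chi R p) (chiD R p_prime) 1) ?chi1 ?zeta_neq1 //.
rewrite mul0r add0r (bigD1 c) //= eqxx mulr1 mulrC big1 ?addr0 // => a /negPf ->.
by rewrite !mulr0.
Qed.

End Walsh.

Theorem theorem6p1 (R : realType) (p m : nat)
    (f : 'rV['F_p]_(2 * m) -> 'F_p)
    (p_prime : prime p) (p_gt2 : (2 < p)%N) (m_gt0 : (0 < m)%N)
    (f_even : forall x, f (- x) = f x) (f0 : f 0 = 0)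
    (f_feasible : feasible_latin f \/ feasible_negative_latin f) :
  bent R f.
Proof.
have pm_neq0 : p%:Z ^+ m != 0.
  by rewrite expf_neq0 // eqz_nat -lt0n prime_gt0.
(* Positivity of m makes q = N / p an integer, here p ^ (m - 1) up to sign. *)
have pmE : p%:Z ^+ m = p%:Z ^+ m.-1 * p%:Z by rewrite -exprSr prednK.
have pm_norm : `|(p%:Z ^+ m)%:~R| = (p ^ m)%:R :> R[i].
  by rewrite rmorphXn /= normrX normr_nat natrX.
move=> x; rewrite -pm_norm; case: f_feasible => feas.
  exact: (@norm_walsh_feasible R _ _ f _ _ p_prime p_gt2 f0 pmE pm_neq0 feas).
rewrite -[RHS]normrN -rmorphN /=.
have NE : - (p%:Z ^+ m) = - p%:Z ^+ m.-1 * p%:Z by rewrite mulNr -pmE.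
apply: (@norm_walsh_feasible R _ _ f _ _ p_prime p_gt2 f0 NE _ feas).
by rewrite oppr_eq0.
Qed.
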